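(* The supremum, over all pairs $((E_1,\pi_1),(E_2,\pi_2))$ of elliptic curves over number fields equipped with standard double covers $\pi_i:E_i\to\mathbb{P}^1$ such that $\pi_1(E_1[2])\neq\pi_2(E_2[2])$, of the cardinality of the intersection of the images of their torsion points satisfies $$\sup_{\{(E_1,E_2)\,:\,\pi_1(E_1[2])\neq\pi_2(E_2[2])\}}\#\big(\pi_1(E_1[\infty])\cap\pi_2(E_2[\infty])\big)\ \geq\ 22.$$
   Context: For an elliptic curve $E$ over a number field, $E[n]\subseteq E(\bar{\mathbb{Q}})$ denotes its $n$-torsion subgroup (all geometric $n$-torsion points) and $E[\infty]=\bigcup_{n\ge 1}E[n]$ is the set of all torsion points. A standard double cover $\pi:E\to\mathbb{P}^1$ is a degree $2$ morphism (defined over $\bar{\mathbb{Q}}$) identifying $P$ with $-P$, i.e. $\pi(P)=\pi(-P)$ for all $P\in E(\bar{\mathbb{Q}})$; no particular coordinate on $\mathbb{P}^1$ is imposed, so $\pi$ is determined by $E$ up to an automorphism of $\mathbb{P}^1$, and $\pi(E[2])$ is the set of its four branch points. Images $\pi(E[n])$, $\pi(E[\infty])$ are subsets of $\mathbb{P}^1(\bar{\mathbb{Q}})$. The supremum is taken in $\mathbb{N}\cup\{\infty\}$. *)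

(* Defs.v *)
From HB Require Import structures.
From mathcomp Require Import all_boot all_order all_algebra all_field.
(* mpoly must be loaded before the classical/analysis files: in the other order
   their notation levels conflict. *)
From mathcomp Require Import mpoly.
From mathcomp Require Import boolp classical_sets cardinality reals.
From mathcomp Require Import constructive_ereal ereal counting_measure.

Set Implicit Arguments.
Unset Strict Implicit.
Unset Printing Implicit Defensive.

Import Order.TTheory GRing.Theory Num.Theory.

Local Open Scope ring_scope.
Local Open Scope classical_set_scope.

(* Generalized Weierstrass equations
     y^2 + a1 x y + a3 y = x^3 + a2 x^2 + a4 x + a6. *)
Record weierstrass (F : fieldType) := Weierstrass {
  wa1 : F; wa2 : F; wa3 : F; wa4 : F; wa6 : F }.

Definition discriminant (F : fieldType) (W : weierstrass F) : F :=
  let: Weierstrass a1 a2 a3 a4 a6 := W in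
  let b2 := a1 ^+ 2 + 4%:R * a2 in
  let b4 := 2%:R * a4 + a1 * a3 in
  let b6 := a3 ^+ 2 + 4%:R * a6 in
  let b8 := a1 ^+ 2 * a6 + 4%:R * a2 * a6 - a1 * a3 * a4 + a2 * a3 ^+ 2
            - a4 ^+ 2 in
  - b2 ^+ 2 * b8 - 8%:R * b4 ^+ 3 - 27%:R * b6 ^+ 2 + 9%:R * b2 * b4 * b6.

Definition base_change (F L : fieldType) (iota : {rmorphism F -> L})
    (W : weierstrass F) : weierstrass L :=
  Weierstrass (iota (wa1 W)) (iota (wa2 W)) (iota (wa3 W)) (iota (wa4 W))
              (iota (wa6 W)).

(* An elliptic curve over a number field.  The number field K, a finite
   extension of the rationals, comes with an embedding into the fixed algebraic
   closure algC of the rationals, so that geometric points make sense. *)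
Record elliptic_curve := EllipticCurve {
  ec_field : fieldExtType rat;
  ec_embed : {rmorphism ec_field -> algC};
  ec_eq : weierstrass ec_field;
  ec_nonsingular : discriminant ec_eq != 0 }.

Definition geometric (E : elliptic_curve) : weierstrass algC :=
  base_change (ec_embed E) (ec_eq E).

(* [Some (x, y)] is an affine point and [None] is the point at infinity O,
   the neutral element of the group law. *)
Definition ec_point := option (algC * algC).

(* E(algC) *)
Definition points (E : elliptic_curve) : set ec_point :=
  [set P | if P is Some (x, y) then
             let: Weierstrass a1 a2 a3 a4 a6 := geometric E in
             y ^+ 2 + a1 * x * y + a3 * y
             = x ^+ 3 + a2 * x ^+ 2 + a4 * x + a6
           else True].

Definition neg_point (E : elliptic_curve) (P : ec_point) : ec_point :=
  if P is Some (x, y) then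
    Some (x, - y - wa1 (geometric E) * x - wa3 (geometric E))
  else None.

(* The chord-and-tangent law; its values are meaningful only when P and Q are
   points of E. *)
Definition add_point (E : elliptic_curve) (P Q : ec_point) : ec_point :=
  match P, Q with
  | None, _ => Q
  | _, None => P
  | Some (x1, y1), Some (x2, y2) =>
    if Q == neg_point E P then None
    else
      let: Weierstrass a1 a2 a3 a4 a6 := geometric E in
      let l := if x1 == x2
               then (3%:R * x1 ^+ 2 + 2%:R * a2 * x1 + a4 - a1 * y1)
                    / (2%:R * y1 + a1 * x1 + a3)
               else (y2 - y1) / (x2 - x1) in
      let nu := y1 - l * x1 in
      let x3 := l ^+ 2 + a1 * l - a2 - x1 - x2 in
      Some (x3, - (l + a1) * x3 - nu - a3)
  end.

Definition mul_point (E : elliptic_curve) (n : nat) (P : ec_point) : ec_point :=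
  iter n (add_point E P) None.

(* E[n] *)
Definition torsion (E : elliptic_curve) (n : nat) : set ec_point :=
  [set P | points E P /\ mul_point E n P = None].

(* E[oo] *)
Definition all_torsion (E : elliptic_curve) : set ec_point :=
  \bigcup_(n in [set n | (1 <= n)%N]) torsion E n.

(* The projective line over algC: [Some t] is [t : 1], [None] is [1 : 0]. *)
Definition proj_line := option algC.

Definition to_proj_line (u v : algC) : proj_line :=
  if v == 0 then None else Some (u / v).

(* Homogeneous coordinates in P^2 of the points of a curve, O being [0 : 1 : 0],
   and homogeneous coordinates on P^1. *)
Definition coord_point (P : ec_point) : 'I_3 -> algC :=
  if P is Some (x, y) then tnth [tuple x; y; 1] else tnth [tuple 0; 1; 0].

Definition coord_line (t : proj_line) : 'I_2 -> algC :=
  if t is Some x then tnth [tuple x; 1] else tnth [tuple 1; 0].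

(* A map from E to P^1 which, in some Zariski neighbourhood of each point of E,
   has the form [F : G] with F, G homogeneous of the same degree. *)
Definition is_morphism (E : elliptic_curve) (p : ec_point -> proj_line) :
    Prop :=
  forall P, points E P ->
  exists (d : nat) (F G : {mpoly algC[3]}),
    [/\ F \is d.-homog, G \is d.-homog,
        ~ (F.@[coord_point P] = 0 /\ G.@[coord_point P] = 0)
      & forall Q, points E Q ->
          ~ (F.@[coord_point Q] = 0 /\ G.@[coord_point Q] = 0) ->
          p Q = to_proj_line F.@[coord_point Q] G.@[coord_point Q]].

(* On an irreducible curve the nonempty open sets are the cofinite sets. *)
Definition almost_all (T : Type) (X : set T) (A : T -> Prop) : Prop :=
  finite_set [set P | X P /\ ~ A P].

(* f agrees on a nonempty open subset of the curve X, embedded in projective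
   space by the homogeneous coordinates c, with a quotient of two homogeneous
   polynomials of the same degree.  The function field of X is the set of such
   functions modulo equality almost everywhere. *)
Definition rational_function (T : Type) (n : nat) (c : T -> 'I_n -> algC)
    (X : set T) (f : T -> algC) : Prop :=
  exists (d : nat) (F G : {mpoly algC[n]}),
    [/\ F \is d.-homog, G \is d.-homog
      & almost_all X (fun P => G.@[c P] != 0 /\ f P = F.@[c P] / G.@[c P])].

Definition rational_on_curve (E : elliptic_curve) :
    (ec_point -> algC) -> Prop :=
  rational_function coord_point (points E).

Definition rational_on_line : (proj_line -> algC) -> Prop :=
  rational_function coord_line setT.

(* The degree of p is m: the function field of E, viewed via pullback along p as
   a vector space over the function field of P^1, has a basis u_0, ..., u_(m-1).
   This never holds for a constant p. *)
Definition has_degree (E : elliptic_curve) (p : ec_point -> proj_line)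
    (m : nat) : Prop :=
  exists u : 'I_m -> ec_point -> algC,
    [/\ forall i, rational_on_curve E (u i),
        forall f, rational_on_curve E f ->
          exists2 h : 'I_m -> proj_line -> algC,
            forall i, rational_on_line (h i)
          & almost_all (points E)
              (fun P => f P = \sum_(i < m) h i (p P) * u i P)
      & forall h : 'I_m -> proj_line -> algC,
          (forall i, rational_on_line (h i)) ->
          almost_all (points E)
            (fun P => \sum_(i < m) h i (p P) * u i P = 0) ->
          forall i, almost_all setT (fun t => h i t = 0)].

Definition standard_double_cover (E : elliptic_curve)
    (p : ec_point -> proj_line) : Prop :=
  [/\ is_morphism E p, has_degree E p 2
    & forall P, points E P -> p P = p (neg_point E P)].

(* Main.v *)
Require Import Defs.
From mathcomp Require Import all_boot all_order all_algebra all_field.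
From mathcomp Require Import mpoly.
From mathcomp Require Import boolp classical_sets cardinality reals.
From mathcomp Require Import constructive_ereal ereal counting_measure.
From mathcomp Require Import ring.

(* Both curves are E : y^2 = x^3 + 4 x^2 + 2 x, which has complex multiplication
   by sqrt (-2), and the two double covers are x and g o x, where
   g(x) = r (x - r) / (x + r) with r^2 = -2.  In the coordinate
   z = (x - sqrt 2) / (x + sqrt 2) the map g is z |-> i z.  The translations by
   E[2] act on the line as a Klein four-group V, generated by z |-> -z and some
   z |-> c / z, which g normalises; hence the common torsion abscissae form a
   union of V-orbits.  The six fixed points of elements of V, of order 4, and
   four free orbits, two of them made of points of orders 3, 6, 6, 6 and two of
   points of order 12, are found to be common to both covers.  They are the
   roots of a separable polynomial [phi] of degree 22, whose set of roots is
   mapped to itself by g^-1.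

   A Moebius transformation of x has degree 2 because 1 and y form a basis of
   the function field of E over the rational functions of x. *)

Set Implicit Arguments.
Unset Strict Implicit.
Unset Printing Implicit Defensive.

Import Order.TTheory GRing.Theory Num.Theory.

Local Open Scope ring_scope.
Local Open Scope classical_set_scope.

(** * Torsion points of the curve *)

Lemma cm_curve_nonsingular :
  discriminant (Weierstrass 0 4 0 2 0 : weierstrass rat^o) != 0.
Proof.
rewrite /discriminant (_ : _ + _ = 512%:R); first by rewrite pnatr_eq0.
ring.
Qed.

Definition cm_curve : elliptic_curve :=
  @EllipticCurve rat^o (@ratr algC) _ cm_curve_nonsingular.

Local Notation E := cm_curve.

Definition cubic (R : pzRingType) (x : R) : R := x ^+ 3 + 4 * x ^+ 2 + 2 * x.

Lemma geometric_cm : geometric E = Weierstrass 0 4 0 2 0.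
Proof.
by rewrite /geometric /base_change /= !rmorph0 !rmorph_nat.
Qed.

Lemma points_cm x y : points E (Some (x, y)) <-> y ^+ 2 = cubic x.
Proof.
by rewrite /points /mkset geometric_cm /cubic !mul0r !addr0.
Qed.

Lemma neg_cm x y : neg_point E (Some (x, y)) = Some (x, - y).
Proof. by rewrite /neg_point geometric_cm /= mul0r !subr0. Qed.

Lemma add_cm x1 y1 x2 y2 :
  add_point E (Some (x1, y1)) (Some (x2, y2)) =
  if Some (x2, y2) == Some (x1, - y1) then None else
  let l := if x1 == x2
           then (3 * x1 ^+ 2 + 2 * 4 * x1 + 2 - 0 * y1)
                / (2 * y1 + 0 * x1 + 0)
           else (y2 - y1) / (x2 - x1) in
  let x3 := l ^+ 2 + 0 * l - 4 - x1 - x2 in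
  Some (x3, - (l + 0) * x3 - (y1 - l * x1) - 0).
Proof. by rewrite -neg_cm /add_point geometric_cm. Qed.

Lemma add_negr P : points E P -> add_point E P (neg_point E P) = None.
Proof.
by case: P => [[x y]|] //; rewrite neg_cm /add_point neg_cm eqxx.
Qed.

(** * Multiples of a point, computed by successive chords through it *)

Section Chain.

Variables t y : algC.
Hypotheses (y_neq0 : y != 0) (Pt : y ^+ 2 = cubic t).

Let P : ec_point := Some (t, y).

Let pt (R : algC * algC) : ec_point := Some (R.1, y * R.2).

Let opp (R : algC * algC) := (R.1, - R.2).

Let ptN R : neg_point E (pt R) = pt (opp R).
Proof. by rewrite neg_cm -mulrN. Qed.

(* The line of slope m * y through P meets the curve again in [pt R] and in
   the opposite of [pt S]: the first two equations are Vieta's formulas.  The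
   ordinates are divided by y, so that no square root of [cubic t] occurs. *)
Definition chord (m : algC) (R S : algC * algC) : Prop :=
  [/\ R.1 + S.1 = cubic t * m ^+ 2 - 4 - t,
      R.1 * S.1 = (t ^+ 2 + 4 * t + 2) * (1 - m * t) ^+ 2,
      R.2 = 1 + m * (R.1 - t) & S.2 = - (1 + m * (S.1 - t))].

(** Read in the other order, the collinear points P, R and -S give P + (-S) = -R. *)
Lemma chord_opp m R S : chord m R S -> chord m (opp S) (opp R).
Proof.
case=> sumRS prodRS eR eS; split=> /=.
- by rewrite addrC.
- by rewrite mulrC.
- by rewrite eS opprK.
- by rewrite eR.
Qed.

Lemma add_chord m R S : chord m R S -> add_point E P (pt R) = pt S.
Proof.
case: R S => [x2 v2] [x3 v3] [/= sumRS prodRS e2 e3].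
have x3E : x3 = cubic t * m ^+ 2 - 4 - t - x2 by rewrite -sumRS; ring.
have slope_eq (l : algC) : l = m * y -> 
    Some (l ^+ 2 + 0 * l - 4 - t - x2,
          - (l + 0) * (l ^+ 2 + 0 * l - 4 - t - x2) - (y - l * t) - 0)
    = Some (x3, y * v3).
  move=> ->; congr (Some (_, _)); first by rewrite x3E -Pt; ring.
  by rewrite e3 x3E -Pt; ring.
apply: etrans (add_cm _ _ _ _) _; rewrite /=.
have [tx2|ntx2] := eqVneq t x2; last first.
  rewrite ifF; last by apply/eqP => -[] /esym/eqP; rewrite (negbTE ntx2).
  apply: slope_eq; rewrite e2; field.
  by rewrite subr_eq0 eq_sym.
have v2E : v2 = 1 by rewrite e2 tx2; ring.
rewrite v2E mulr1 -tx2 ifF; last first.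
  apply/negP => /eqP [] /eqP; rewrite -subr_eq0 opprK.
  by rewrite -mulr2n mulrn_eq0 (negbTE y_neq0).
rewrite [X in _ - t - X]tx2; apply: slope_eq.
(* In the tangent case R also has abscissa t, and Vieta's product formula then says that the
   derivative of the cubic at t is 2 y^2 m, so m * y is the tangent slope. *)
have slope : 3 * t ^+ 2 + 2 * 4 * t + 2 = 2 * cubic t * m.
  move/eqP: prodRS; rewrite x3E -tx2 -subr_eq0 => h.
  apply/eqP; rewrite eq_sym -subr_eq0; move: h; congr (_ == _).
  by rewrite /cubic; ring.
rewrite !mul0r !addr0 subr0 slope -Pt; field.
exact: y_neq0.
Qed.

(** Each term is the previous one plus P, so a chain starting at (t, 1) lists P, 2 P, 3 P, and so
    on. *)
Fixpoint chain (R : algC * algC) (s : seq (algC * algC)) : Prop :=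
  if s is R' :: s' then (exists m, chord m R R') /\ chain R' s' else True.

Lemma mul_chain k R s :
  chain R s -> mul_point E k P = pt R ->
  mul_point E (k + size s) P = pt (last R s).
Proof.
elim: s k R => [|R1 s IHs] k R /=; first by rewrite addn0.
case=> [[m /add_chord PR] /IHs IH] kP.
by rewrite addnS -addSn IH // /mul_point iterS -/(mul_point E k P) kP.
Qed.

(** The chain is run backwards: by [chord_opp], adding P to the opposite of a term gives the
    opposite of its predecessor. *)
Lemma mul_chain_opp k R s :
  chain R s -> mul_point E k P = pt (opp (last R s)) ->
  mul_point E (k + size s) P = pt (opp R).
Proof.
elim: s k R => [|R1 s IHs] k R /=; first by rewrite addn0.
case=> [[m /chord_opp/add_chord PS] /IHs IH] /IH kP.
by rewrite addnS /mul_point iterS -/(mul_point E _ P) kP.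
Qed.

(** If k P = -P, then (k + 1) P = O. A last term of ordinate 0 is its own opposite, so the opposites
    of the terms, in reverse order, continue the list of multiples down to -P. *)
Lemma torsion_chain s :
  chain (t, 1) s -> last (t, 1) s = (t, -1) \/ (last (t, 1) s).2 = 0 ->
  all_torsion E P.
Proof.
move=> chs last_s.
have ptP : pt (t, 1) = P by rewrite /pt mulr1.
have mul1 : mul_point E 1 P = pt (t, 1) by rewrite ptP.
have torsP k : mul_point E k P = pt (t, -1) -> all_torsion E P.
  move=> kP; exists k.+1 => //; split; first exact/points_cm.
  rewrite /mul_point iterS -/(mul_point E k P) kP.
  have -> : pt (t, -1) = neg_point E P by rewrite neg_cm /pt mulrN1.
  by apply: add_negr; apply/points_cm.
have mulS := mul_chain chs mul1.
case: last_s => last_s.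
  by apply: (torsP (1 + size s)%N); rewrite mulS last_s.
apply: (torsP (1 + size s + size s)%N).
rewrite (mul_chain_opp chs) // mulS.
by case: (last _ s) last_s => x v /= ->; rewrite /opp oppr0.
Qed.

End Chain.

(** * Abscissae of points of orders 3, 4, 6 and 12 *)

Definition torsion_abscissa (t : algC) : Prop :=
  exists y, all_torsion E (Some (t, y)).

(** The inverse [c] of [cubic t] certifies that the ordinate of the point is nonzero. *)
Lemma torsion_abscissa_chain (t c : algC) s :
  cubic t * c = 1 -> chain t (t, 1) s ->
  last (t, 1) s = (t, -1) \/ (last (t, 1) s).2 = 0 ->
  torsion_abscissa t.
Proof.
move=> fc chs last_s; exists (sqrtC (cubic t)).
apply: torsion_chain chs last_s; last by rewrite sqrtCK.
rewrite sqrtC_eq0; apply/eqP => f0; move/eqP: fc.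
by rewrite f0 mul0r eq_sym oner_eq0.
Qed.

(* In the lemmas below the k-th multiple of the point P over t is
   (xk, y * vk), and y * mk is the slope of the line through P and k P. *)
Lemma torsion_abscissa3 (r : algC) :
  r ^+ 2 = - 2 ->
  torsion_abscissa ((r - 2) / 3).
Proof.
move=> rE.
pose c : algC := (5 * r - 2) / 8.
pose m1 : algC := (- 2 * r - 1) / 2.
pose x2 : algC := (r - 2) / 3.
pose v2 : algC := - 1.
(* Here 2 P = -P. *)
apply: (@torsion_abscissa_chain ((r - 2) / 3) c [:: (x2, v2)]); last by left.
  by rewrite /cubic /c; field: rE.
split.
  exists m1; rewrite /chord /cubic /= /m1 /x2 /v2.
  by split; field: rE.
by [].
Qed.

(** The chain ends at 3 P = (0, 0), which has order 2. *)
Lemma torsion_abscissa6 (r : algC) :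
  r ^+ 2 = - 2 ->
  torsion_abscissa (r - 2).
Proof.
move=> rE.
pose c : algC := (r + 2) / 24.
pose m1 : algC := (- 2 * r - 1) / 6.
pose x2 : algC := (- r - 2) / 3.
pose v2 : algC := (2 * r + 1) / 9.
pose m2 : algC := (- r - 2) / 6.
pose x3 : algC := 0.
pose v3 : algC := 0.
apply: (@torsion_abscissa_chain (r - 2) c [:: (x2, v2); (x3, v3)]);
  last by right.
  by rewrite /cubic /c; field: rE.
split.
  exists m1; rewrite /chord /cubic /= /m1 /x2 /v2.
  by split; field: rE.
split.
  exists m2; rewrite /chord /cubic /= /x2 /v2 /m2 /x3 /v3.
  by split; field: rE.
by [].
Qed.

(** The tangent at P gives 2 P = (0, 0). *)
Lemma torsion_abscissa4 (t : algC) :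
  t ^+ 2 = 2 ->
  torsion_abscissa t.
Proof.
move=> tE.
pose c : algC := (- t + 2) / 8.
pose m1 : algC := t / 2.
pose x2 : algC := 0.
pose v2 : algC := 0.
apply: (@torsion_abscissa_chain t c [:: (x2, v2)]); last by right.
  by rewrite /cubic /c; field: tE.
split.
  exists m1; rewrite /chord /cubic /= /m1 /x2 /v2.
  by split; field: tE.
by [].
Qed.

(** Here 2 P is one of the two other points of order 2, of abscissae -2 + sqrt 2 and -2 - sqrt 2. *)
Lemma torsion_abscissa4' (t : algC) :
  t ^+ 4 = - 8 * t ^+ 3 - 12 * t ^+ 2 - 16 * t - 4 ->
  torsion_abscissa t.
Proof.
move=> tE.
pose c : algC := (- 11 * t ^+ 3 - 84 * t ^+ 2 - 102 * t - 144) / 32.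
pose m1 : algC := (t ^+ 3 + 6 * t ^+ 2 - 2 * t + 4) / 16.
pose x2 : algC := (- t ^+ 3 - 8 * t ^+ 2 - 10 * t - 16) / 4.
pose v2 : algC := 0.
apply: (@torsion_abscissa_chain t c [:: (x2, v2)]); last by right.
  by rewrite /cubic /c; field: tE.
split.
  exists m1; rewrite /chord /cubic /= /m1 /x2 /v2.
  by split; field: tE.
by [].
Qed.

(** Here 3 P is a point of order 2 other than (0, 0). *)
Lemma torsion_abscissa6' (t : algC) :
  t ^+ 4 = - 12 * t ^+ 2 - 4 ->
  torsion_abscissa t.
Proof.
move=> tE.
pose c : algC := (- 5 * t ^+ 3 - 4 * t ^+ 2 - 58 * t - 48) / 96.
pose m1 : algC := (- 9 * t ^+ 3 + 2 * t ^+ 2 - 110 * t + 28) / 48.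
pose x2 : algC := (- t ^+ 3 - 10 * t - 8) / 12.
pose v2 : algC := (- 3 * t ^+ 3 + 4 * t ^+ 2 - 34 * t + 56) / 72.
pose m2 : algC := (t ^+ 2 - 4 * t + 14) / 48.
pose x3 : algC := (- t ^+ 2 - 14) / 4.
pose v3 : algC := 0.
apply: (@torsion_abscissa_chain t c [:: (x2, v2); (x3, v3)]); last by right.
  by rewrite /cubic /c; field: tE.
split.
  exists m1; rewrite /chord /cubic /= /m1 /x2 /v2.
  by split; field: tE.
split.
  exists m2; rewrite /chord /cubic /= /x2 /v2 /m2 /x3 /v3.
  by split; field: tE.
by [].
Qed.

(** The chain stops at 6 P = (0, 0), passing through 3 P of order 4, with abscissa -a, and 4 P of
    order 3, with abscissa e - 2. The two roots of the equation for t have product 2: they are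
    exchanged by the translation by (0, 0). *)
Lemma torsion_abscissa12 (a e t : algC) :
  a ^+ 2 = 2 -> e ^+ 2 = 6 -> t ^+ 2 = 2 * (1 - a) * (2 + e) * t - 2 ->
  torsion_abscissa t.
Proof.
move=> a2 e2 t2.
pose c : algC := (2 * a * e * t + 2 * e * t + 4 * a * t + 6 * t + 3 * a * e
  + 11 * e + 6 * a + 28) / 8.
pose m1 : algC := (- a * e * t - e * t - 2 * a * t - 5 * t - 5 * a * e
  - e - 10 * a - 4) / 4.
pose x2 : algC := e + 2.
pose v2 : algC := (5 * a * e * t + 8 * e * t + 12 * a * t + 20 * t
  + 22 * a * e + 8 * e + 54 * a + 20) / 4.
pose m2 : algC := (3 * a * e * t + 8 * e * t + 10 * a * t + 10 * t
  + 16 * a * e + 6 * e + 50 * a + 4) / 16.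
pose x3 : algC := - a.
pose v3 : algC := (a * e * t + 2 * t + 4 * e - 4 * a + 16) / 4.
pose m3 : algC := (- a * e * t - 4 * e * t - 6 * a * t - 6 * t - 12 * a * e
  - 2 * e - 30 * a + 4) / 16.
pose x4 : algC := e - 2.
pose v4 : algC := (a * e * t + 4 * t + 2 * a * e + 6 * a + 4) / 4.
pose m4 : algC := (e * t + a * t + t + 4 * a * e - 3 * e + 10 * a - 8) / 4.
pose x5 : algC := - t - 2 * a * e + 2 * e - 4 * a + 4.
pose v5 : algC := a * e * t - e * t + 2 * a * t - 2 * t - 16 * a * e
  + 24 * e - 40 * a + 59.
pose m5 : algC := (- t - 2 * a * e + 2 * e - 4 * a + 4) / 2.
pose x6 : algC := 0.
pose v6 : algC := 0.
apply: (@torsion_abscissa_chain t c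
  [:: (x2, v2); (x3, v3); (x4, v4); (x5, v5); (x6, v6)]);
  last by right.
  by rewrite /cubic /c; field: a2 e2 t2.
split.
  exists m1; rewrite /chord /cubic /= /m1 /x2 /v2.
  by split; field: a2 e2 t2.
split.
  exists m2; rewrite /chord /cubic /= /x2 /v2 /m2 /x3 /v3.
  by split; field: a2 e2 t2.
split.
  exists m3; rewrite /chord /cubic /= /x3 /v3 /m3 /x4 /v4.
  by split; field: a2 e2 t2.
split.
  exists m4; rewrite /chord /cubic /= /x4 /v4 /m4 /x5 /v5.
  by split; field: a2 e2 t2.
split.
  exists m5; rewrite /chord /cubic /= /x5 /v5 /m5 /x6 /v6.
  by split; field: a2 e2 t2.
by [].
Qed.

(** * Moebius transformations of the abscissa are double covers *)

Lemma to_proj_line_scale k u v :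
  k != 0 -> to_proj_line (k * u) (k * v) = to_proj_line u v.
Proof.
move=> k0; rewrite /to_proj_line mulf_eq0 (negbTE k0) /=.
by case: eqP => // /eqP v0; rewrite -mulf_div divff // mul1r.
Qed.

Definition mobius (a b c d : algC) (t : proj_line) : proj_line :=
  if t is Some x then to_proj_line (a * x + b) (c * x + d)
  else to_proj_line a c.

Lemma mobius_to_proj_line a b c d u v :
  (u != 0) || (v != 0) ->
  mobius a b c d (to_proj_line u v) =
  to_proj_line (a * u + b * v) (c * u + d * v).
Proof.
rewrite /to_proj_line; have [->|v0 _] := eqVneq v 0.
  rewrite orbF => u0 /=; rewrite !mulr0 !addr0 -/(to_proj_line _ _).
  by rewrite -/(to_proj_line (a * u) _) ![_ * u]mulrC to_proj_line_scale.
rewrite -/(to_proj_line _ (c * u + d * v)).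
rewrite [mobius _ _ _ _ _]/= -(to_proj_line_scale _ _ v0).
by congr to_proj_line; field.
Qed.

Lemma mobiusK a b c d :
  a * d - b * c != 0 -> cancel (mobius a b c d) (mobius d (- b) (- c) a).
Proof.
move=> det0 [x|] /=; last first.
  rewrite mobius_to_proj_line; last first.
    apply: contraNT det0; rewrite negb_or !negbK => /andP[/eqP-> /eqP->].
    by rewrite mul0r mulr0 subr0.
  have -> : - c * a + a * c = 0 by ring.
  by rewrite /to_proj_line eqxx.
rewrite mobius_to_proj_line; last first.
  apply: contraNT det0; rewrite negb_or !negbK => /andP[/eqP h1 /eqP h2].
  have -> : a * d - b * c = a * (c * x + d) - c * (a * x + b) by ring.
  by rewrite h1 h2 !mulr0 subr0.
have -> : d * (a * x + b) + - b * (c * x + d) = (a * d - b * c) * x by ring.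
have -> : - c * (a * x + b) + a * (c * x + d) = (a * d - b * c) * 1 by ring.
by rewrite to_proj_line_scale // /to_proj_line oner_eq0 divr1.
Qed.

Lemma mobiusKV a b c d :
  a * d - b * c != 0 -> cancel (mobius d (- b) (- c) a) (mobius a b c d).
Proof.
move=> det0 t; have := @mobiusK d (- b) (- c) a.
by rewrite !opprK; apply; rewrite mulrNN mulrC.
Qed.

(** * Cofinite sets and polynomial functions on the curve *)

Lemma finite_roots (p : {poly algC}) :
  p != 0 -> finite_set [set x | root p x].
Proof.
move=> p0; have [r def_p] := closed_field_poly_normal p.
apply: sub_finite_set (finite_seq r) => x /=.
by rewrite def_p rootZ ?lead_coef_eq0 // root_prod_XsubC.
Qed.

Lemma infinite_algC : ~ finite_set [set: algC].
Proof.
move=> fin; apply: infinite_nat.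
rewrite -[setT](preimage_setT (fun n : nat => n%:R : algC)).
apply: finite_preimage fin => m n _ _ /eqP.
by rewrite eqr_nat => /eqP.
Qed.

Definition cubic_poly : {poly algC} := 'X ^+ 3 + 4 *: 'X ^+ 2 + 2 *: 'X.

Lemma horner_cubic x : cubic_poly.[x] = cubic x.
Proof. by rewrite /cubic_poly /cubic !hornerE. Qed.

Lemma cubic_poly_neq0 : cubic_poly != 0.
Proof.
apply/eqP => /(congr1 (fun p => p.[1])).
rewrite horner_cubic horner0 /cubic => /eqP.
rewrite (_ : _ + _ = 7%:R); first by rewrite pnatr_eq0.
by ring.
Qed.

(** At most two points lie over each abscissa, so finiteness can be tested on abscissae; O is a
    single further exception. *)
Lemma almost_all_curveP (Q : ec_point -> Prop) :
  almost_all (points E) Q <->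
  exists2 A : set algC, finite_set A &
    forall x y, ~ A x -> points E (Some (x, y)) -> Q (Some (x, y)).
Proof.
split=> [fin|[A finA QA]].
  exists ((fun P => if P is Some (x, _) then x else 0) @`
            [set P | points E P /\ ~ Q P]); first exact: finite_image.
  move=> x y nx Pxy; apply: contrapT => nQ; apply: nx.
  by exists (Some (x, y)).
pose s (x : algC) : algC := sqrtC (cubic x).
pose B : set ec_point := [set None] `|`
  ((fun x => Some (x, s x)) @` A `|` (fun x => Some (x, - s x)) @` A).
have finB : finite_set B.
  by rewrite !finite_setU; split; [|split];
     [exact: finite_set1|exact: finite_image..].
apply: sub_finite_set finB => -[[x y]|] [] PE nQ; last by left.
have Ax : A x by apply: contrapT => nA; apply/nQ/QA.
move/points_cm: PE => /eqP; rewrite -(sqrtCK (cubic x)) eqf_sqr.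
by move=> /orP[] /eqP ->; right; [left|right]; exists x.
Qed.

Lemma exists_point x : exists y, points E (Some (x, y)).
Proof. by exists (sqrtC (cubic x)); apply/points_cm; rewrite sqrtCK. Qed.

(** Functions A(x) + B(x) y are closed under sums and products, since y^2 is a polynomial in x on
    the curve; they contain the constants and the coordinates. *)
Lemma meval_curve (F : {mpoly algC[3]}) :
  exists A B : {poly algC}, forall x y, points E (Some (x, y)) ->
    F.@[coord_point (Some (x, y))] = A.[x] + B.[x] * y.
Proof.
pose good (f : algC -> algC -> algC) := exists A B : {poly algC},
  forall x y, points E (Some (x, y)) -> f x y = A.[x] + B.[x] * y.
have goodC c : good (fun _ _ => c).
  by exists c%:P, 0 => x y _; rewrite hornerC horner0 mul0r addr0.
have goodD f g : good f -> good g -> good (fun x y => f x y + g x y).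
  move=> [A [B fE]] [C [D gE]]; exists (A + C), (B + D) => x y Pxy.
  by rewrite fE // gE // !hornerD; ring.
have goodM f g : good f -> good g -> good (fun x y => f x y * g x y).
  move=> [A [B fE]] [C [D gE]].
  exists (A * C + cubic_poly * B * D), (A * D + B * C) => x y Pxy.
  rewrite fE // gE // hornerD !hornerM horner_cubic hornerD !hornerM.
  by move/points_cm: Pxy => <-; ring.
have goodX i : good (fun x y => coord_point (Some (x, y)) i).
  case: i => [[|[|[|//]]] lti].
  - exists 'X, 0 => x y _.
    by rewrite hornerX horner0 mul0r addr0 /coord_point (tnth_nth 0).
  - exists 0, 1 => x y _.
    by rewrite horner0 hornerC mul1r add0r /coord_point (tnth_nth 0).
  - exists 1, 0 => x y _.
    by rewrite horner0 hornerC mul0r addr0 /coord_point (tnth_nth 0).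
have goodXn i n : good (fun x y => coord_point (Some (x, y)) i ^+ n).
  elim: n => [|n IHn]; first exact: goodC.
  have [A [B AB]] := goodM _ _ (goodX i) IHn.
  by exists A, B => x y Pxy; rewrite exprS; apply: AB.
suff : good (fun x y => F.@[coord_point (Some (x, y))]) by [].
elim/mpolyind: F => [|c m p _ _ IHp].
  have [A [B AB]] := goodC 0.
  by exists A, B => x y Pxy; rewrite meval0; apply: AB.
have goodm :
  good (fun x y => c * \prod_(i < 3) coord_point (Some (x, y)) i ^+ m i).
  have [A [B AB]] := goodM _ _ (goodC c) (goodM _ _ (goodXn ord0 (m ord0))
    (goodM _ _ (goodXn (lift ord0 ord0) (m (lift ord0 ord0)))
      (goodXn (lift ord0 (lift ord0 ord0)) (m (lift ord0 (lift ord0 ord0)))))).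
  by exists A, B => x y Pxy; rewrite !big_ord_recl big_ord0 mulr1; apply: AB.
have [A [B AB]] := goodD _ _ goodm IHp.
by exists A, B => x y Pxy; rewrite mevalD mevalZ mevalX; apply: AB.
Qed.

Lemma dhomogXU n (i : 'I_n) : ('X_i : {mpoly algC[n]}) \is 1.-homog.
Proof. by rewrite dhomogX; apply/eqP; exact: mdeg1. Qed.

Lemma dhomog_linear_exp n (f : {mpoly algC[n]}) k :
  f \is 1.-homog -> f ^+ k \is k.-homog.
Proof. by move/(dhomogMn k); rewrite mul1n. Qed.

(** [omap fst] is the abscissa as a map to the projective line, with O sent to infinity. *)
Definition cover (a b c d : algC) (P : ec_point) : proj_line :=
  mobius a b c d (omap fst P).

(** * The morphism property and the degree of a Moebius transformation of x *)

Section DoubleCover.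

Variables a b c d : algC.
Hypothesis det_neq0 : a * d - b * c != 0.

Let M := mobius a b c d.

Let p := cover a b c d.

Lemma mobius_coords_neq0 x : (a * x + b != 0) || (c * x + d != 0).
Proof.
apply: contraNT det_neq0; rewrite negb_or !negbK => /andP[/eqP h1 /eqP h2].
have -> : a * d - b * c = a * (c * x + d) - c * (a * x + b) by ring.
by rewrite h1 h2 !mulr0 subr0.
Qed.

Lemma almost_all_line (A : set algC) (Q : proj_line -> Prop) :
  finite_set A -> (forall x, ~ A x -> Q (M (Some x))) -> almost_all setT Q.
Proof.
move=> finA QA.
have finB : finite_set (M @` ([set None] `|` some @` A)).
  apply: finite_image; rewrite finite_setU; split; first exact: finite_set1.
  exact: finite_image.
apply: sub_finite_set finB => t [] _ nQ.
exists (mobius d (- b) (- c) a t); last exact: mobiusKV.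
have := mobiusKV det_neq0 t.
case: (mobius _ _ _ _ t) => [x|] xt; last by left.
right; exists x => //; apply: contrapT => nA; apply: nQ.
by rewrite -xt; apply: QA.
Qed.

Lemma finite_poles : finite_set [set x | c * x + d = 0].
Proof.
have cd0 : c%:P * 'X + d%:P != 0 :> {poly algC}.
  apply/eqP => cd; have := det_neq0.
  have d0 : d = 0.
    have := congr1 (fun q => q.[0]) cd.
    by rewrite hornerD hornerM !hornerC hornerX mulr0 add0r.
  have c0 : c = 0.
    have := congr1 (fun q => q.[1]) cd.
    by rewrite hornerD hornerM !hornerC hornerX mulr1 d0 addr0.
  by rewrite c0 d0 !mulr0 subr0 eqxx.
apply: sub_finite_set (finite_roots cd0) => x /= cx.
by rewrite rootE hornerD hornerM !hornerC hornerX cx.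
Qed.

(* The homogenisation, in the degree n, of the composite of q with the inverse
   of the Moebius map. *)
Definition homogenize (n : nat) (q : {poly algC}) : {mpoly algC[2]} :=
  \sum_(i < n.+1) q`_i *:
    ((d *: 'X_ord0 - b *: 'X_ord_max) ^+ i
      * (a *: 'X_ord_max - c *: 'X_ord0) ^+ (n - i)).

Lemma homogenize_homog n q : homogenize n q \is n.-homog.
Proof.
apply: rpred_sum => i _; apply: dhomogZ.
rewrite -[X in X.-homog](subnKC (ltnSE (ltn_ord i))).
by apply: dhomogM; apply: dhomog_linear_exp;
  apply: rpredB; apply/dhomogZ/dhomogXU.
Qed.

Lemma meval_homogenize n (q : {poly algC}) x :
  (size q <= n.+1)%N -> c * x + d != 0 ->
  (homogenize n q).@[coord_line (M (Some x))]
  = ((a * d - b * c) / (c * x + d)) ^+ n * q.[x].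
Proof.
move=> leqn v0; rewrite /M /= /to_proj_line (negbTE v0) /homogenize.
rewrite (raddf_sum (meval _)) /= (horner_coef_wide _ leqn) mulr_sumr.
apply: eq_bigr => i _.
rewrite mevalZ mevalM !rmorphXn /= !(mevalB, mevalZ, mevalXU) !(tnth_nth 0) /=.
rewrite [RHS]mulrCA; congr (_ * _).
have -> : d * ((a * x + b) / (c * x + d)) - b * 1
   = (a * d - b * c) / (c * x + d) * x by field.
have -> : a * 1 - c * ((a * x + b) / (c * x + d))
   = (a * d - b * c) / (c * x + d) by field.
rewrite exprMn mulrAC -exprD subnKC //.
by rewrite -ltnS.
Qed.

(** Numerator and denominator are homogenised in a common degree [n], so the factor in
    [meval_homogenize] cancels in the quotient. *)
Lemma rational_on_line_quotient (q r : {poly algC}) : r != 0 ->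
  exists2 h : proj_line -> algC, rational_on_line h &
  exists2 A : set algC, finite_set A &
    forall x, ~ A x -> h (M (Some x)) = q.[x] / r.[x].
Proof.
move=> r0; pose n := maxn (size q) (size r).
have leq : (size q <= n.+1)%N by rewrite leqW // leq_maxl.
have ler : (size r <= n.+1)%N by rewrite leqW // leq_maxr.
pose A : set algC := [set x | c * x + d = 0] `|` [set x | root r x].
have finA : finite_set A.
  by rewrite finite_setU; split; [exact: finite_poles|exact: finite_roots].
have scale0 x : c * x + d != 0 -> ((a * d - b * c) / (c * x + d)) ^+ n != 0.
  by move=> v0; rewrite expf_neq0 // mulf_neq0 // invr_eq0.
exists (fun t => (homogenize n q).@[coord_line t]
                 / (homogenize n r).@[coord_line t]).
  exists n, (homogenize n q), (homogenize n r).
  split; [exact: homogenize_homog..|apply: (almost_all_line finA) => x nA].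
  have v0 : c * x + d != 0 by apply/eqP => v0; apply: nA; left.
  split=> //; rewrite meval_homogenize // mulf_neq0 ?scale0 //.
  by apply/eqP => rx; apply: nA; right; rewrite /= rootE rx.
exists A => // x nA.
have v0 : c * x + d != 0 by apply/eqP => v0; apply: nA; left.
by rewrite !meval_homogenize // -mulf_div divff ?scale0 // mul1r.
Qed.

Lemma mobius_morphism : is_morphism E p.
Proof.
move=> [[x0 y0]|] _.
  exists 1, (a *: 'X_ord0 + b *: 'X_ord_max), (c *: 'X_ord0 + d *: 'X_ord_max).
  split=> [| | |Q _].
  - by apply: rpredD; apply/dhomogZ/dhomogXU.
  - by apply: rpredD; apply/dhomogZ/dhomogXU.
  - rewrite !(mevalD, mevalZ, mevalXU) /coord_point !(tnth_nth 0) /= !mulr1.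
    move=> -[/eqP h1 /eqP h2].
    by have := mobius_coords_neq0 x0; rewrite h1 h2.
  - rewrite !(mevalD, mevalZ, mevalXU) /coord_point.
    case: Q => [[x y]|]; rewrite !(tnth_nth 0) /=.
      by rewrite !mulr1.
    by rewrite !mulr0 !addr0 => -[].
(* The linear forms used at affine points vanish at O = [0 : 1 : 0]. On the curve y^2 z = x k with k
   = x^2 + 4 x z + 2 z^2, so [x : z] = [y^2 : k], and the right-hand side is defined at O. *)
pose Y : 'I_3 := inord 1.
have homogXX (i j : 'I_3) : ('X_i * 'X_j : {mpoly algC[3]}) \is 2.-homog.
  by rewrite (@dhomogM _ _ _ 1 _ 1) // dhomogXU.
have homogY : ('X_Y ^+ 2 : {mpoly algC[3]}) \is 2.-homog := homogXX Y Y.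
have [k homogk mevalk] : exists2 k : {mpoly algC[3]}, k \is 2.-homog &
    forall v, k.@[v] =
      v ord0 ^+ 2 + 4 * (v ord0 * v ord_max) + 2 * v ord_max ^+ 2.
  exists ('X_ord0 ^+ 2 + 4 *: ('X_ord0 * 'X_ord_max) + 2 *: 'X_ord_max ^+ 2).
    by apply: rpredD; [apply: rpredD; [|apply: dhomogZ]|apply: dhomogZ];
       apply: homogXX.
  by move=> v; rewrite !(mevalD, mevalZ, mevalM, mevalXU).
have mevalY v : ('X_Y ^+ 2 : {mpoly algC[3]}).@[v] = v Y ^+ 2.
  by rewrite rmorphXn /= mevalXU.
exists 2, (a *: 'X_Y ^+ 2 + b *: k), (c *: 'X_Y ^+ 2 + d *: k).
split=> [| | |Q].
- by apply: rpredD; apply: dhomogZ.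
- by apply: rpredD; apply: dhomogZ.
- rewrite !(mevalD, mevalZ) mevalk mevalY /coord_point !(tnth_nth 0).
  rewrite /Y inordK //=.
  rewrite !(expr0n, expr1n, mul0r, mulr0, mulr1, addr0) => -[a0 c0].
  by move: det_neq0; rewrite a0 c0 mul0r mulr0 subr0 eqxx.
- rewrite !(mevalD, mevalZ) mevalk mevalY /coord_point.
  case: Q => [[x y]|]; rewrite !(tnth_nth 0) /Y inordK //=; last first.
    by rewrite !(expr0n, expr1n, mul0r, mulr0, mulr1, addr0).
  move=> /points_cm ->; rewrite !mulr1 expr1n mulr1.
  set z := x ^+ 2 + 4 * x + 2.
  have -> : a * cubic x + b * z = z * (a * x + b) by rewrite /cubic /z; ring.
  have -> : c * cubic x + d * z = z * (c * x + d) by rewrite /cubic /z; ring.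
  have [->|z0] := eqVneq z 0; first by rewrite !mul0r => -[].
  by rewrite to_proj_line_scale.
Qed.

Definition ordinate (P : ec_point) : algC := if P is Some (_, y) then y else 0.

Lemma rational_ordinate : rational_on_curve E ordinate.
Proof.
exists 1, 'X_(inord 1), 'X_ord_max; split; [exact: dhomogXU..|].
apply/almost_all_curveP; exists set0 => // x y _ _.
by rewrite !mevalXU /coord_point !(tnth_nth 0) inordK //= oner_neq0 divr1.
Qed.

Lemma rational_one : rational_on_curve E (fun=> 1).
Proof.
exists 0, 1, 1; split; [exact: dhomog1..|].
apply/almost_all_curveP; exists set0 => // x y _ _.
by rewrite !meval1 divr1 oner_neq0.
Qed.

(** The denominator B0 + B1 y is made rational in x by multiplying with its conjugate B0 - B1 y. The
    norm [r] is nonzero outside [A], because the denominator is nonzero at both (x, y) and (x,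
    -y). *)
Lemma rational_on_curve_decomp f : rational_on_curve E f ->
  exists q0 q1 r : {poly algC}, r != 0 /\
    almost_all (points E) (fun P => if P is Some (x, y) then
       f P = q0.[x] / r.[x] + q1.[x] / r.[x] * y else True).
Proof.
move=> [n [F [G [_ _ /almost_all_curveP [A finA fE]]]]].
have [A0 [A1 FE]] := meval_curve F; have [B0 [B1 GE]] := meval_curve G.
pose r := B0 ^+ 2 - cubic_poly * B1 ^+ 2.
have rE x y : points E (Some (x, y)) ->
    r.[x] = (B0.[x] + B1.[x] * y) * (B0.[x] - B1.[x] * y).
  move=> /points_cm Pxy.
  by rewrite /r hornerD hornerN !hornerM horner_cubic -Pxy; ring.
have oppP x y : points E (Some (x, y)) -> points E (Some (x, - y)).
  by move=> /points_cm Pxy; apply/points_cm; rewrite sqrrN.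
have G_neq0 x y : ~ A x -> points E (Some (x, y)) -> B0.[x] + B1.[x] * y != 0.
  by move=> nA Pxy; rewrite -GE //; case: (fE _ _ nA Pxy).
have r_neq0 x : ~ A x -> r.[x] != 0.
  move=> nA; have [y Pxy] := exists_point x.
  rewrite (rE _ _ Pxy) mulf_neq0 ?G_neq0 // -mulrN.
  by apply: G_neq0 => //; exact: oppP.
exists (A0 * B0 - cubic_poly * A1 * B1), (A1 * B0 - A0 * B1), r; split.
  apply/eqP => r0; apply: infinite_algC; apply: sub_finite_set finA => x _.
  by apply: contrapT => /r_neq0; rewrite r0 horner0 eqxx.
apply/almost_all_curveP; exists A => // x y nA Pxy.
have [_ ->] := fE _ _ nA Pxy; rewrite FE // GE //.
have g0 := G_neq0 _ _ nA Pxy; have := r_neq0 _ nA.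
rewrite (rE _ _ Pxy) mulf_eq0 negb_or => /andP[_ g1].
have /points_cm y2 := Pxy.
rewrite !hornerD !hornerN !hornerM horner_cubic -y2; field.
by rewrite g0 g1.
Qed.

Lemma mobius_degree2 : has_degree E p 2.
Proof.
exists (fun i => if i == ord0 then fun=> 1 else ordinate); split.
- by move=> i; case: ifP => _; [exact: rational_one|exact: rational_ordinate].
- move=> f /rational_on_curve_decomp.
  move=> [q0 [q1 [r [r0 /almost_all_curveP[A finA fE]]]]].
  have [h0 rh0 [A0 finA0 h0E]] := rational_on_line_quotient q0 r0.
  have [h1 rh1 [A1 finA1 h1E]] := rational_on_line_quotient q1 r0.
  exists (fun i => if i == ord0 then h0 else h1); first by move=> i; case: ifP.
  apply/almost_all_curveP; exists (A `|` (A0 `|` A1)).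
    by rewrite !finite_setU.
  move=> x y nA Pxy; rewrite big_ord_recl big_ord1 /= mulr1.
  rewrite (fE x y) //; last by move=> Ax; apply: nA; left.
  rewrite /p /cover -[omap _ _]/(Some x).
  rewrite h0E; last by move=> Ax; apply: nA; right; left.
  by rewrite h1E // => Ax; apply: nA; right; right.
(* Linear independence: evaluation at P and -P gives u + v y = u - v y = 0, and y is nonzero outside
   the roots of the cubic. *)
- move=> h _ /almost_all_curveP [A finA hE].
  pose B := A `|` [set x | root cubic_poly x].
  have h0 x : ~ B x -> forall i, h i (M (Some x)) = 0.
    move=> nA; have nAx : ~ A x by move=> Ax; apply: nA; left.
    have [y /[dup] Pxy /points_cm y2] := exists_point x.
    have y0 : y != 0.
      apply/eqP => y0; apply: nA; right.
      by rewrite /= rootE horner_cubic -y2 y0 expr0n.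
    have Pxy' : points E (Some (x, - y)) by apply/points_cm; rewrite sqrrN.
    have := hE _ _ nAx Pxy; have := hE _ _ nAx Pxy'.
    rewrite !big_ord_recl !big_ord0 /= !addr0 !mulr1.
    set u := h _ _; set v := h _ _ => e1 e2.
    have u0 : u = 0.
      have : u * 2 = 0 by rewrite -[RHS](addr0 0) -{1}e1 -e2; ring.
      by move/eqP; rewrite mulf_eq0 pnatr_eq0 orbF => /eqP.
    have v0 : v = 0.
      move: e2; rewrite u0 add0r => /eqP.
      by rewrite mulf_eq0 (negbTE y0) orbF => /eqP.
    move=> i; case: (unliftP ord0 i) => [j ->|-> //].
    by rewrite (ord1 j).
  move=> i; apply: (almost_all_line (A := B)).
    by rewrite finite_setU; split; last exact: (finite_roots cubic_poly_neq0).
  by move=> x nA; apply: h0.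
Qed.

Lemma mobius_double_cover : standard_double_cover E p.
Proof.
split; [exact: mobius_morphism|exact: mobius_degree2|].
by move=> [[x y]|] _ //; rewrite neg_cm.
Qed.

End DoubleCover.

(** * The common abscissae *)

(* The roots of phi_n and phi_n' are abscissae of points of order n. *)
Definition phi4 : {poly algC} := Poly [:: -2; 0; 1].
Definition phi4' : {poly algC} := Poly [:: 4; 16; 12; 8; 1].
Definition phi3 : {poly algC} := Poly [:: 2; 4; 3].
Definition phi6 : {poly algC} := Poly [:: 6; 4; 1].
Definition phi6' : {poly algC} := Poly [:: 4; 0; 12; 0; 1].
Definition phi12 : {poly algC} :=
  Poly [:: 16; -128; -416; -448; -360; -224; -104; -16; 1].

(** The leading power is expressed by the lower ones, so that identities at a root can be checked
    modulo the polynomial. *)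
Lemma root_phi4 x : root phi4 x = (x ^+ 2 == 2).
Proof.
by rewrite rootE horner_Poly /= -[RHS]subr_eq0; congr (_ == _); ring.
Qed.

Lemma root_phi4' x :
  root phi4' x = (x ^+ 4 == - 8 * x ^+ 3 - 12 * x ^+ 2 - 16 * x - 4).
Proof.
by rewrite rootE horner_Poly /= -[RHS]subr_eq0; congr (_ == _); ring.
Qed.

(** Since [phi3] is not monic, its roots are parametrised by the square roots of -2; completing the
    square gives s = 3 x + 2. *)
Lemma root_phi3 x : root phi3 x -> exists2 s, s ^+ 2 = -2 & x = (s - 2) / 3.
Proof.
rewrite rootE horner_Poly /= => /eqP px; exists (3 * x + 2); last by field.
apply/eqP; rewrite -subr_eq0; apply/eqP.
by rewrite -[RHS](mulr0 3) -[in RHS]px; ring.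
Qed.

Lemma root_phi6 x : root phi6 x = (x ^+ 2 == - 4 * x - 6).
Proof.
by rewrite rootE horner_Poly /= -[RHS]subr_eq0; congr (_ == _); ring.
Qed.

Lemma root_phi6' x : root phi6' x = (x ^+ 4 == - 12 * x ^+ 2 - 4).
Proof.
by rewrite rootE horner_Poly /= -[RHS]subr_eq0; congr (_ == _); ring.
Qed.

Lemma root_phi12 x : root phi12 x =
  (x ^+ 8 == 16 * x ^+ 7 + 104 * x ^+ 6 + 224 * x ^+ 5 + 360 * x ^+ 4
             + 448 * x ^+ 3 + 416 * x ^+ 2 + 128 * x - 16).
Proof.
by rewrite rootE horner_Poly /= -[RHS]subr_eq0; congr (_ == _); ring.
Qed.

Definition phi : {poly algC} :=
  phi4 * (phi4' * (phi3 * (phi6 * (phi6' * phi12)))).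

Lemma root_phiE x : root phi x =
  [|| root phi4 x, root phi4' x, root phi3 x, root phi6 x, root phi6' x
    | root phi12 x].
Proof. by rewrite !rootM. Qed.

Lemma torsion_abscissa_phi x : root phi x -> torsion_abscissa x.
Proof.
rewrite root_phiE => /orP[|/orP[|/orP[|/orP[|/orP[]]]]].
- by rewrite root_phi4 => /eqP /torsion_abscissa4.
- by rewrite root_phi4' => /eqP /torsion_abscissa4'.
- by case/root_phi3 => s s2 ->; apply: torsion_abscissa3.
- rewrite root_phi6 => /eqP x2.
  have -> : x = (x + 2) - 2 by ring.
  by apply: torsion_abscissa6; ring: x2.
- by rewrite root_phi6' => /eqP /torsion_abscissa6'.
rewrite root_phi12 -subr_eq0 => x8.
pose a : algC := sqrtC 2; pose e : algC := sqrtC 6.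
have a2 : a ^+ 2 = 2 by rewrite sqrtCK.
have e2 : e ^+ 2 = 6 by rewrite sqrtCK.
have Na2 : (- a) ^+ 2 = 2 by rewrite sqrrN.
have Ne2 : (- e) ^+ 2 = 6 by rewrite sqrrN.
(* Over Q(sqrt 2, sqrt 6), [phi12] is the product of four quadratics, one for each choice of the
   signs of a and e. *)
pose f (a e : algC) := x ^+ 2 - (2 * (1 - a) * (2 + e) * x - 2).
have factor : f a e * f a (- e) * (f (- a) e * f (- a) (- e)) == 0.
  by move: x8; congr (_ == _); rewrite /f; ring: a2 e2.
move: factor; rewrite !mulf_eq0 !subr_eq0.
by move=> /orP[/orP[]|/orP[]] /eqP; apply: torsion_abscissa12.
Qed.

(** The map is g^-1. It fixes the roots of [phi4], permutes those of each of [phi4'], [phi6'] and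
    [phi12], and moves the roots of [phi3] and [phi6] in one cycle: (-r - 2) / 3, (r - 2) / 3, r -
    2, -r - 2. *)
Lemma phi_mobius r x : r ^+ 2 = -2 -> root phi x ->
  r - x != 0 /\ root phi ((r * x - 2) / (r - x)).
Proof.
move=> r2.
have neq0 (y z : algC) : y * z = 1 -> y != 0.
  by move=> yz; apply/eqP => y0; move/eqP: yz; rewrite y0 mul0r eq_sym oner_eq0.
have inv (y z : algC) : y * z = 1 -> y != 0 /\ y^-1 = z.
  move=> yz; split; first exact: neq0 yz.
  by rewrite -[LHS]mulr1 -yz mulKf // (neq0 _ _ yz).
have Nr2 : (- r) ^+ 2 = -2 by rewrite sqrrN.
have phi_s (s : algC) :
    s ^+ 2 = -2 -> root phi ((s - 2) / 3) /\ root phi (s - 2).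
  move=> s2; rewrite !root_phiE; split; last first.
    suff -> : root phi6 (s - 2) by rewrite !orbT.
    by rewrite root_phi6; apply/eqP; ring: s2.
  suff -> : root phi3 ((s - 2) / 3) by rewrite !orbT.
  by rewrite rootE horner_Poly /=; apply/eqP; field: s2.
rewrite {1}root_phiE => /orP[|/orP[|/orP[|/orP[|/orP[]]]]].
- rewrite root_phi4 => /eqP x2.
  have rx : r - x != 0 by apply: (neq0 _ (- (r + x) / 4)); field: r2 x2.
  split=> //; rewrite root_phiE root_phi4.
  have -> : (r * x - 2) / (r - x) = x by field: r2 x2.
  by rewrite x2 eqxx.
- rewrite root_phi4' => /eqP x4.
  have rx : r - x != 0.
    (* The product of r - x and -(r + x) is x^2 + 2, which the last factor inverts modulo [phi4'].
       The witnesses for [phi6'] and [phi12] are built in the same way. *)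
    apply: (neq0 _ (- (r + x) * ((x ^+ 2 + 8 * x + 10) / 16))).
    by field: r2 x4.
  split=> //; rewrite root_phiE root_phi4'; apply/orP; right; apply/orP; left.
  by apply/eqP; field: r2 x4.
- case/root_phi3 => s s2 ->.
  have /orP[/eqP rs|/eqP rs] : (s == r) || (s == - r) by rewrite -eqf_sqr r2 s2.
    have [|-> ->] := inv (r - (s - 2) / 3) ((1 - r) / 2).
      by rewrite rs; field: r2.
    split=> //; case: (phi_s _ r2) => _; congr (root phi _).
    by rewrite rs; field: r2.
  have [|-> ->] := inv (r - (s - 2) / 3) ((1 - 2 * r) / 6).
    by rewrite rs; field: r2.
  split=> //; case: (phi_s _ r2) => + _; congr (root phi _).
  by rewrite rs; field: r2.
- rewrite root_phi6 => /eqP x2.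
  have s2 : (x + 2) ^+ 2 = -2 by ring: x2.
  have /orP[/eqP rs|/eqP rs] : (x + 2 == r) || (x + 2 == - r).
    by rewrite -eqf_sqr r2 s2.
    have {x2 s2 rs} -> : x = r - 2 by rewrite -rs; ring.
    have [|-> ->] := inv (r - (r - 2)) (1 / 2); first by field.
    split=> //; case: (phi_s _ Nr2) => _; congr (root phi _).
    by field: r2.
  have {x2 s2 rs} -> : x = - r - 2 by rewrite -rs; ring.
  have [|-> ->] := inv (r - (- r - 2)) ((1 - r) / 6); first by field: r2.
  split=> //; case: (phi_s _ Nr2) => + _; congr (root phi _).
  by field: r2.
- rewrite root_phi6' => /eqP x4.
  have rx : r - x != 0.
    by apply: (neq0 _ (- (r + x) * ((x ^+ 2 + 10) / 16))); field: r2 x4.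
  split=> //; rewrite root_phiE root_phi6'.
  by do 4![apply/orP; right]; apply/orP; left; apply/eqP; field: r2 x4.
rewrite root_phi12 => /eqP x8.
pose c := (- x ^+ 6 + 16 * x ^+ 5 + 106 * x ^+ 4 + 192 * x ^+ 3 + 148 * x ^+ 2
           + 64 * x + 120) / 256.
have rx : r - x != 0.
  by apply: (neq0 _ (- (r + x) * c)); rewrite /c; field: r2 x8.
split=> //; rewrite root_phiE root_phi12; do 5![apply/orP; right].
by apply/eqP; field: r2 x8.
Qed.

(** * Degree and separability of [phi] *)

Lemma size_PolyK (s : seq algC) : last 1 s != 0 -> size (Poly s) = size s.
Proof. by move=> s0; rewrite (PolyK s0). Qed.

Lemma size_phi : size phi = 23%N.
Proof.
have three0 : (3 : algC) != 0 by rewrite pnatr_eq0.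
have s4 : size phi4 = 3%N by rewrite size_PolyK //= oner_neq0.
have s4' : size phi4' = 5%N by rewrite size_PolyK //= oner_neq0.
have s3 : size phi3 = 3%N by rewrite size_PolyK.
have s6 : size phi6 = 3%N by rewrite size_PolyK //= oner_neq0.
have s6' : size phi6' = 5%N by rewrite size_PolyK //= oner_neq0.
have s12 : size phi12 = 9%N by rewrite size_PolyK //= oner_neq0.
have nz (p : {poly algC}) n : size p = n.+1 -> p != 0.
  by move=> sp; rewrite -size_poly_eq0 sp.
have nz6 := nz _ _ s12; have nz5 := nz _ _ s6'; have nz4 := nz _ _ s6.
have nz3 := nz _ _ s3; have nz2 := nz _ _ s4'; have nz1 := nz _ _ s4.
rewrite /phi !size_mul ?mulf_neq0 //.
by rewrite s4 s4' s3 s6 s6' s12.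
Qed.

(** Over an algebraically closed field it is enough to exclude common roots; [y] is the value at x
    of an inverse of q modulo p. *)
Lemma coprimep_inverse (p q : {poly algC}) :
  (forall x, root p x -> exists y, q.[x] * y = 1) -> coprimep p q.
Proof.
move=> inv; apply/Pdiv.ClosedField.coprimepP => x /inv [y qy].
by apply/eqP => q0; move/eqP: qy; rewrite q0 mul0r eq_sym oner_eq0.
Qed.

Lemma horner_deriv_Poly (y : algC) s x :
  (Poly (y :: s))^`().[x] = (Poly s).[x] + (Poly s)^`().[x] * x.
Proof. by rewrite /= cons_poly_def derivMXaddC hornerD hornerMX. Qed.

Lemma phi_separable : separable_poly phi.
Proof.
rewrite /phi !separable_mul !coprimepMr.
(* In the names [cij] the factors are numbered in their order in [phi]; each witness is the inverse
   of the second factor modulo the first. *)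
have c12 : coprimep phi4 phi4'.
  apply: coprimep_inverse => x; rewrite root_phi4 => /eqP xE.
  by exists ((x - 1) / 32); rewrite horner_Poly /=; field: xE.
have c13 : coprimep phi4 phi3.
  apply: coprimep_inverse => x; rewrite root_phi4 => /eqP xE.
  by exists ((2 - x) / 8); rewrite horner_Poly /=; field: xE.
have c14 : coprimep phi4 phi6.
  apply: coprimep_inverse => x; rewrite root_phi4 => /eqP xE.
  by exists ((2 - x) / 8); rewrite horner_Poly /=; field: xE.
have c15 : coprimep phi4 phi6'.
  apply: coprimep_inverse => x; rewrite root_phi4 => /eqP xE.
  by exists (1 / 32); rewrite horner_Poly /=; field: xE.
have c16 : coprimep phi4 phi12.
  apply: coprimep_inverse => x; rewrite root_phi4 => /eqP xE.
  by exists ((2 * x - 3) / 1024); rewrite horner_Poly /=; field: xE.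
have c23 : coprimep phi4' phi3.
  apply: coprimep_inverse => x; rewrite root_phi4' => /eqP xE.
  exists ((7 * x ^+ 3 + 54 * x ^+ 2 + 66 * x + 76) / 64).
  by rewrite horner_Poly /=; field: xE.
have c24 : coprimep phi4' phi6.
  apply: coprimep_inverse => x; rewrite root_phi4' => /eqP xE.
  exists ((x ^+ 3 + 6 * x ^+ 2 - 2 * x + 12) / 64).
  by rewrite horner_Poly /=; field: xE.
have c25 : coprimep phi4' phi6'.
  apply: coprimep_inverse => x; rewrite root_phi4' => /eqP xE.
  exists ((5 * x ^+ 3 + 40 * x ^+ 2 + 58 * x + 64) / 256).
  by rewrite horner_Poly /=; field: xE.
have c26 : coprimep phi4' phi12.
  apply: coprimep_inverse => x; rewrite root_phi4' => /eqP xE.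
  exists ((15 * x ^+ 3 + 114 * x ^+ 2 + 134 * x + 186) / 4096).
  by rewrite horner_Poly /=; field: xE.
have c34 : coprimep phi3 phi6.
  apply: coprimep_inverse => x /root_phi3 [s sE ->].
  by exists ((4 - s) / 16); rewrite horner_Poly /=; field: sE.
have c35 : coprimep phi3 phi6'.
  apply: coprimep_inverse => x /root_phi3 [s sE ->].
  by exists ((7 * s + 8) / 128); rewrite horner_Poly /=; field: sE.
have c36 : coprimep phi3 phi12.
  apply: coprimep_inverse => x /root_phi3 [s sE ->].
  by exists ((17 - 56 * s) / 4096); rewrite horner_Poly /=; field: sE.
have c45 : coprimep phi6 phi6'.
  apply: coprimep_inverse => x; rewrite root_phi6 => /eqP xE.
  by exists ((x + 2) / 128); rewrite horner_Poly /=; field: xE.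
have c46 : coprimep phi6 phi12.
  apply: coprimep_inverse => x; rewrite root_phi6 => /eqP xE.
  by exists (1 / 4096); rewrite horner_Poly /=; field: xE.
have c56 : coprimep phi6' phi12.
  apply: coprimep_inverse => x; rewrite root_phi6' => /eqP xE.
  by exists ((3 * x ^+ 2 + 35) / 4096); rewrite horner_Poly /=; field: xE.
rewrite c12 c13 c14 c15 c16 c23 c24 c25 c26 c34 c35 c36 c45 c46 c56 !andbT.
have d4 x : phi4^`().[x] = 2 * x.
  by rewrite !horner_deriv_Poly deriv0 !horner_Poly /=; ring.
have d4' x : phi4'^`().[x] = 4 * x ^+ 3 + 24 * x ^+ 2 + 24 * x + 16.
  by rewrite !horner_deriv_Poly deriv0 !horner_Poly /=; ring.
have d3 x : phi3^`().[x] = 6 * x + 4.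
  by rewrite !horner_deriv_Poly deriv0 !horner_Poly /=; ring.
have d6 x : phi6^`().[x] = 2 * x + 4.
  by rewrite !horner_deriv_Poly deriv0 !horner_Poly /=; ring.
have d6' x : phi6'^`().[x] = 4 * x ^+ 3 + 24 * x.
  by rewrite !horner_deriv_Poly deriv0 !horner_Poly /=; ring.
have d12 x : phi12^`().[x] = 8 * x ^+ 7 - 112 * x ^+ 6 - 624 * x ^+ 5
    - 1120 * x ^+ 4 - 1440 * x ^+ 3 - 1344 * x ^+ 2 - 832 * x - 128.
  by rewrite !horner_deriv_Poly deriv0 !horner_Poly /=; ring.
apply/and5P; split; [| | | |apply/andP; split]; rewrite unlock;
  apply: coprimep_inverse => x.
- rewrite root_phi4 => /eqP xE.
  by exists (x / 4); rewrite d4; field: xE.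
- rewrite root_phi4' => /eqP xE.
  exists ((3 * x ^+ 3 + 24 * x ^+ 2 + 34 * x + 32) / 256).
  by rewrite d4'; field: xE.
- case/root_phi3 => s sE ->.
  by exists (- s / 4); rewrite d3; field: sE.
- rewrite root_phi6 => /eqP xE.
  by exists (- (x + 2) / 4); rewrite d6; field: xE.
- rewrite root_phi6' => /eqP xE.
  exists (- (3 * x ^+ 3 + 34 * x) / 256).
  by rewrite d6'; field: xE.
- rewrite root_phi12 => /eqP xE.
  (* With w = x + 2 / x, phi12 is x ^+ 4 times a quartic W in w, and at a root
     its derivative is x ^+ 2 * (x ^+ 2 - 2) * W'(w). *)
  have x0 : x != 0.
    apply/eqP => x0; move/eqP: xE.
    by rewrite x0 !expr0n /= !mulr0 !addr0 add0r eq_sym oppr_eq0 pnatr_eq0.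
  pose w := x + 2 / x.
  have wE : w ^+ 4 = 16 * w ^+ 3 + 112 * w ^+ 2 + 128 * w - 64.
    by rewrite /w; field: xE.
  pose W' := 4 * w ^+ 3 - 48 * w ^+ 2 - 224 * w - 128.
  have dE : phi12^`().[x] = x ^+ 3 * (x - 2 / x) * W'.
    by rewrite d12 /W' /w; field: xE.
  (* [I] and [J] are the inverses of w^2 - 8 = (x - 2 / x)^2 and of W'(w) modulo W. *)
  pose I := (- w ^+ 3 + 19 * w ^+ 2 + 56 * w - 56) / 256.
  pose J := (9 * w ^+ 3 - 164 * w ^+ 2 - 632 * w + 32) / (192 * 256).
  have wI : (x - 2 / x) ^+ 2 * I = 1.
    have -> : (x - 2 / x) ^+ 2 = w ^+ 2 - 8 by rewrite /w; field.
    by rewrite /I; field: wE.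
  have wJ : W' * J = 1 by rewrite /W' /J; field: wE.
  exists ((x - 2 / x) / x ^+ 3 * I * J).
  transitivity ((x - 2 / x) ^+ 2 * I * (W' * J)); last by rewrite wI wJ mulr1.
  by rewrite dE; field.
Qed.

(** * Counting the common images *)

(** An infinite set has counting measure +oo, so the bound holds in that case too. *)
Lemma counting_ge (T : choiceType) (R : realType) (X : set T) (s : seq T) :
  uniq s -> (forall x, x \in s -> X x) ->
  ((size s)%:R%:E <= counting X :> \bar R)%E.
Proof.
move=> us sX; rewrite /counting; case: asboolP => [finX|_]; last exact: leey.
rewrite lee_fin ler_nat; apply: uniq_leq_size us _ => x /sX Xx.
by rewrite in_fset_set // inE.
Qed.

Lemma abscissa_phi_roots :
  exists2 s : seq algC,
    uniq s /\ size s = 22%N & forall x, x \in s -> root phi x.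
Proof.
have [s phiE] := closed_field_poly_normal phi.
have lc0 : lead_coef phi != 0 by rewrite lead_coef_eq0 -size_poly_eq0 size_phi.
exists s; last by move=> x xs; rewrite phiE rootZ // root_prod_XsubC.
split; last first.
  by have := size_phi; rewrite phiE size_scale // size_prod_XsubC => -[].
rewrite -separable_prod_XsubC; have := phi_separable.
rewrite phiE !unlock derivZ coprimepZl // coprimepZr //.
Qed.

(** The branch point 0 of the first cover separates the two sets: under the second, O goes to r, and
    an affine point over 0 has abscissa r, whereas [cubic r] = -8 shows that no point of order 2 has
    this abscissa. *)
Lemma mobius_torsion2_neq (r : algC) : r ^+ 2 = -2 ->
  cover 1 0 0 1 @` torsion E 2 <> cover r 2 1 r @` torsion E 2.
Proof.
move=> r2.
have r0 : r != 0.
  by apply/eqP => r0; move/eqP: r2; rewrite r0 expr0n eq_sym oppr_eq0 pnatr_eq0.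
have mul2 P : mul_point E 2 P = add_point E P P by case: P => [[]|].
have : (cover 1 0 0 1 @` torsion E 2) (Some 0).
  exists (Some (0, 0)); last first.
    by rewrite /cover /= /to_proj_line !mul0r add0r oner_eq0 mulr0 !add0r divr1.
  split; first by apply/points_cm; rewrite /cubic; ring.
  by rewrite mul2 add_cm ifT // oppr0.
move=> + eqT; rewrite eqT => -[[[x y]|] [Pxy]]; last first.
  rewrite /cover /= /to_proj_line oner_eq0 divr1 => _ [] /eqP.
  by rewrite (negbTE r0).
rewrite mul2 add_cm; case: eqP => // -[yN] _; move/points_cm: Pxy => Pxy.
rewrite /cover /= /to_proj_line; case: eqP => // /eqP d0 [] /eqP.
rewrite mulf_eq0 invr_eq0 (negbTE d0) orbF => rx.
have xr : x = r.
  apply: (mulfI r0); apply/eqP; rewrite -subr_eq0; move: rx; congr (_ == _).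
  by ring: r2.
have y0 : y = 0.
  apply/eqP; have : y + y == 0 by rewrite {1}yN addNr.
  by rewrite -mulr2n mulrn_eq0.
move/eqP: Pxy; rewrite xr y0 expr0n /= (_ : cubic r = - 8).
  by rewrite eq_sym oppr_eq0 pnatr_eq0.
by rewrite /cubic; ring: r2.
Qed.

Theorem theorem1 (R : realType) :
  (22%:R%:E <= ereal_sup
     [set c : \bar R |
        exists (E1 E2 : elliptic_curve) (p1 p2 : ec_point -> proj_line),
          [/\ standard_double_cover E1 p1, standard_double_cover E2 p2,
              p1 @` torsion E1 2 <> p2 @` torsion E2 2
            & c = counting (p1 @` all_torsion E1 `&` p2 @` all_torsion E2)]])%E.
Proof.
pose r : algC := sqrtC (-2); have r2 : r ^+ 2 = -2 by rewrite sqrtCK.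
(* [p1] is x and [p2] is g o x, since r (x - r) = r x + 2. *)
pose p1 := cover 1 0 0 1.
pose p2 := cover r 2 1 r.
pose X := p1 @` all_torsion E `&` p2 @` all_torsion E.
have [s [us sz] sphi] := abscissa_phi_roots.
apply: (@le_trans _ _ (counting X)); last first.
  apply: ereal_sup_ubound; exists E, E, p1, p2; split=> //.
  - by apply: mobius_double_cover; rewrite mulr1 mulr0 subr0 oner_neq0.
  - apply: mobius_double_cover; rewrite -expr2 r2 mulr1.
    rewrite (_ : _ - _ = - 4%:R); last by ring.
    by rewrite oppr_eq0 pnatr_eq0.
  - exact: mobius_torsion2_neq.
rewrite -sz -(size_map some); apply: counting_ge.
  by rewrite map_inj_uniq // => x y [].
move=> _ /mapP[x /sphi phix ->].
have [rx phiu] := phi_mobius r2 phix.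
(* The value x is the image under [p1] of a torsion point over x, and under [p2] of a torsion point
   over g^-1(x). *)
split.
  have [y Py] := torsion_abscissa_phi phix; exists (Some (x, y)) => //.
  by rewrite /p1 /cover /= /to_proj_line mul1r mul0r add0r oner_eq0 addr0 divr1.
have [y Py] := torsion_abscissa_phi phiu.
exists (Some ((r * x - 2) / (r - x), y)) => //.
have det0 : r * r - 2 * 1 != 0.
  rewrite -expr2 r2 mulr1 (_ : _ - _ = - 4%:R); last by ring.
  by rewrite oppr_eq0 pnatr_eq0.
rewrite -(mobiusKV det0 (Some x)); congr mobius.
by rewrite /= /to_proj_line mulN1r [- x + r]addrC (negbTE rx).
Qed.
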